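(* Let $m\le n$ be positive integers and $q\in\mathbb C$ not a root of unity. Let $\gamma\in\Pi_{m,n}$. Then the two-sided ideal of $\mathcal O_q(G_{m,n}(\mathbb C))$ generated by $\{[\pi]:\pi\in\Pi_{m,n},\ \pi\not\ge_{\rm st}\gamma\}$ is generated by this same set as a right ideal.
   Context: $\mathcal O_q(M_{m,n}(\mathbb C))$ is the $\mathbb C$-algebra generated by $X_{ij}$ ($1\le i\le m$, $1\le j\le n$) subject to: $X_{ij}X_{il}=qX_{il}X_{ij}$ for $j<l$; $X_{ij}X_{kj}=qX_{kj}X_{ij}$ for $i<k$; $X_{ij}X_{kl}=X_{kl}X_{ij}$ for $k<i$, $j<l$; $X_{ij}X_{kl}-X_{kl}X_{ij}=(q-q^{-1})X_{il}X_{kj}$ for $i<k$, $j<l$. $\Pi_{m,n}$ is the set of $m$-subsets $\{j_1<\dots<j_m\}$ of $\{1,\dots,n\}$ ordered by $\{i_1<\dots<i_m\}\le_{\rm st}\{j_1<\dots<j_m\}$ iff $i_s\le j_s$ for all $s$; $[J]=\sum_{\sigma\in\mathfrak S_m}(-q)^{\ell(\sigma)}X_{1j_{\sigma(1)}}\cdots X_{mj_{\sigma(m)}}$. $\mathcal O_q(G_{m,n}(\mathbb C))$ is the subalgebra generated by all $[J]$. *)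

(* Defs.v *)
(* The complex numbers are modelled as R[i] = complex R
   (mathcomp-real-closed) for an arbitrary R : realType (every realType is
   isomorphic to the reals, so R[i] is a model of C). *)
From HB Require Import structures.
From mathcomp Require Import all_boot all_order all_algebra all_fingroup.
From mathcomp Require Import reals complex.
Set Implicit Arguments. Unset Strict Implicit. Unset Printing Implicit Defensive.
Import Order.TTheory GRing.Theory Num.Theory.
Local Open Scope ring_scope.

Section QMat.
Variable (K : fieldType).

Definition is_root_of_unity_q (q : K) : Prop := exists k : nat, (0 < k)%N /\ q ^+ k = 1.

Definition qmat_rel (m n : nat) (q : K) (A : algType K) (X : nat -> nat -> A) : Prop :=
  forall i j k l : nat,
    (1 <= i <= m)%N -> (1 <= k <= m)%N -> (1 <= j <= n)%N -> (1 <= l <= n)%N ->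
    [/\ (j < l)%N -> X i j * X i l = q *: (X i l * X i j),
        (i < k)%N -> X i j * X k j = q *: (X k j * X i j),
        (k < i)%N -> (j < l)%N -> X i j * X k l = X k l * X i j &
        (i < k)%N -> (j < l)%N ->
          X i j * X k l - X k l * X i j = (q - q^-1) *: (X i l * X k j)].

Inductive gen_alg (A : algType K) (G : A -> Prop) : A -> Prop :=
| gen_alg_gen a : G a -> gen_alg G a
| gen_alg_one : gen_alg G 1
| gen_alg_add a b : gen_alg G a -> gen_alg G b -> gen_alg G (a + b)
| gen_alg_mul a b : gen_alg G a -> gen_alg G b -> gen_alg G (a * b)
| gen_alg_scale (c : K) a : gen_alg G a -> gen_alg G (c *: a).

Definition is_gen (A : algType K) (m n : nat) (X : nat -> nat -> A) : A -> Prop :=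
  fun a => exists i j, [/\ (1 <= i <= m)%N, (1 <= j <= n)%N & a = X i j].

(* (A, X) is the algebra O_q(M_{m,n}(K)) with its generators X_ij:
   the X_ij satisfy the relations, generate A, and A has the universal
   property of the algebra presented by these generators and relations. *)
Definition is_qmatrix_algebra (m n : nat) (q : K) (A : algType K)
    (X : nat -> nat -> A) : Prop :=
  [/\ qmat_rel m n q X,
      (forall a : A, gen_alg (is_gen m n X) a) &
      forall (B : algType K) (Y : nat -> nat -> B), qmat_rel m n q Y ->
        exists f : A -> B,
          [/\ forall a b, f (a + b) = f a + f b,
              forall a b, f (a * b) = f a * f b,
              forall (c : K) a, f (c *: a) = c *: f a,
              f 1 = 1 &
              forall i j, (1 <= i <= m)%N -> (1 <= j <= n)%N -> f (X i j) = Y i j]].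

(* Pi_{m,n}: m-subsets {j_1 < ... < j_m} of {1..n}, as increasing lists. *)
Definition Pi (m n : nat) (J : seq nat) : bool :=
  [&& size J == m, sorted ltn J & all (fun j => (1 <= j <= n)%N) J].

Definition le_st (I J : seq nat) : bool :=
  all (fun s => nth 0%N I s <= nth 0%N J s)%N (iota 0 (size I)).

Definition perm_length (m : nat) (s : 'S_m) : nat :=
  #|[set p : 'I_m * 'I_m | (p.1 < p.2)%N && (s p.2 < s p.1)%N]|.

Definition qminor (m : nat) (q : K) (A : algType K) (X : nat -> nat -> A)
    (J : seq nat) : A :=
  \sum_(s : 'S_m) (- q) ^+ perm_length s *:
     \prod_(k < m) X k.+1 (nth 0%N J (s k)).

Arguments qminor m q {A} X J.

Definition qgrass (m n : nat) (q : K) (A : algType K) (X : nat -> nat -> A) : A -> Prop :=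
  gen_alg (fun a => exists J, Pi m n J /\ a = qminor m q X J).

Inductive twosided_ideal (A : algType K) (S G : A -> Prop) : A -> Prop :=
| tsi_gen a : G a -> twosided_ideal S G a
| tsi_zero : twosided_ideal S G 0
| tsi_add a b : twosided_ideal S G a -> twosided_ideal S G b -> twosided_ideal S G (a + b)
| tsi_mull r a : S r -> twosided_ideal S G a -> twosided_ideal S G (r * a)
| tsi_mulr a r : S r -> twosided_ideal S G a -> twosided_ideal S G (a * r).

Inductive right_ideal (A : algType K) (S G : A -> Prop) : A -> Prop :=
| ri_gen a : G a -> right_ideal S G a
| ri_zero : right_ideal S G 0
| ri_add a b : right_ideal S G a -> right_ideal S G b -> right_ideal S G (a + b)
| ri_mulr a r : S r -> right_ideal S G a -> right_ideal S G (a * r).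

End QMat.

(* Main.v *)
Require Import Defs.
From HB Require Import structures.
From mathcomp Require Import all_boot all_order all_algebra all_fingroup.
From mathcomp Require Import reals complex ring zify.

(** It suffices to write a product [J][I] as a linear combination of products
    [L][M] with #(L <= c) >= #(I <= c) for every c: since I >= gamma fails exactly
    when #(I < gamma_s) >= s for some s, every such L also fails to be >= gamma.
    The relations say that the Hecke operators, acting at adjacent positions,
    act in the same way on the row indices and on the column indices of a
    monomial in the X_ij.  Moving the m letters of one antisymmetric block
    across the other one, position by position, multiplies the row coefficients
    of [J][I] by q^m, because the antisymmetric tensors on m letters in 1..m
    form a line.  Applied to the column indices of [J][I], the same product of
    Hecke operators gives terms [L][M] in which a letter of I has only been
    replaced by a smaller letter of J. *)

Set Implicit Arguments. Unset Strict Implicit. Unset Printing Implicit Defensive.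
Import Order.TTheory GRing.Theory Num.Theory.
Local Open Scope ring_scope.

(** * Hecke operators on functions of words *)

Section HeckeAction.
Variables (K : fieldType) (q : K).

(* The operator [hecke a] is the swap of the letters a, a+1 plus this diagonal;
   the swap fixes x = y, so the eigenvalue there is q.  The eigenvalues of
   [hecke a] are q and - q^-1. *)
Definition hecke_diag (x y : nat) : K :=
  if x == y then q - 1 else if (x < y)%N then q - q^-1 else 0.

Fixpoint hecke (V : lmodType K) (a : nat) (F : seq nat -> V) (w : seq nat) : V :=
  match a, w with
  | 0, [:: x, y & v] => hecke_diag x y *: F w + F [:: y, x & v]
  | b.+1, x :: v => hecke b (fun v' => F (x :: v')) v
  | _, _ => 0
  end.

(** The head of [s] is the outermost operator, so it is the first to act on the word at which the
    result is evaluated. *)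
Definition heckes (V : lmodType K) (s : seq nat) (F : seq nat -> V) : seq nat -> V :=
  foldr (@hecke V) F s.

Definition word (Q : pred nat) (k : nat) (w : seq nat) : bool :=
  (size w == k) && all Q w.

Lemma word_cons Q k x w : word Q k.+1 (x :: w) = Q x && word Q k w.
Proof. by rewrite /word /= eqSS andbCA. Qed.

Lemma word_cat Q k l u v : size u = k -> word Q (k + l) (u ++ v) = word Q k u && word Q l v.
Proof.
by move=> <-; rewrite /word size_cat all_cat eqn_add2l eqxx /= andbCA.
Qed.

Lemma eq_hecke (V : lmodType K) Q k a (F G : seq nat -> V) :
  (forall w, word Q k w -> F w = G w) ->
  forall w, word Q k w -> hecke a F w = hecke a G w.
Proof.
elim: a k F G => [|a IHa] k F G FG [|x w] //=.
  case: w => [//|y w] Hw; rewrite !FG //.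
  by move: Hw; rewrite /word /= [X in _ && X]andbCA.
case: k FG => [|k] FG; first by rewrite /word.
rewrite word_cons => /andP[Qx Hw].
by apply: (IHa k) => // v Hv; apply: FG; rewrite word_cons Qx.
Qed.

Lemma eq_heckes (V : lmodType K) Q k s (F G : seq nat -> V) :
  (forall w, word Q k w -> F w = G w) ->
  forall w, word Q k w -> heckes s F w = heckes s G w.
Proof. by move=> FG; elim: s => //= a s IHs; apply: eq_hecke. Qed.

Lemma hecke_linear (V : lmodType K) a c (F G : seq nat -> V) w :
  hecke a (fun v => c *: F v + G v) w = c *: hecke a F w + hecke a G w.
Proof.
elim: a F G w => [|a IHa] F G [|x w] //=; rewrite ?scaler0 ?addr0 //.
case: w => [|y w]; first by rewrite scaler0 addr0.
rewrite !scalerDr !scalerA [hecke_diag x y * c]mulrC -!addrA; congr (_ + _).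
by rewrite addrCA.
Qed.

Lemma eq_hecke_all (V : lmodType K) a (F G : seq nat -> V) : F =1 G -> hecke a F =1 hecke a G.
Proof.
move=> FG w; apply: (@eq_hecke _ predT (size w)) => [v _|]; first exact: FG.
by rewrite /word eqxx; apply/allP.
Qed.

Lemma eq_heckes_all (V : lmodType K) s (F G : seq nat -> V) :
  F =1 G -> heckes s F =1 heckes s G.
Proof. by move=> FG; elim: s => //= a s IHs; apply: eq_hecke_all. Qed.

Lemma heckes_linear (V : lmodType K) s c (F G : seq nat -> V) w :
  heckes s (fun v => c *: F v + G v) w = c *: heckes s F w + heckes s G w.
Proof.
elim: s w => //= a s IHs w.
by rewrite -hecke_linear; apply: eq_hecke_all.
Qed.

Lemma heckes_scale (V : lmodType K) s c (F : seq nat -> V) w :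
  heckes s (fun v => c *: F v) w = c *: heckes s F w.
Proof.
have z0 : heckes s (fun=> 0 : V) w = 0.
  have := heckes_linear s 1 (fun=> 0 : V) (fun=> 0) w.
  have E : heckes s (fun v => 1 *: 0 + 0 : V) w = heckes s (fun=> 0) w.
    by apply: eq_heckes_all => v; rewrite scaler0 addr0.
  by rewrite E scale1r -{1}[LHS]addr0 => /addrI.
rewrite -[RHS]addr0 -z0 -heckes_linear.
by apply: eq_heckes_all => v; rewrite addr0.
Qed.

Lemma heckes_shift (V : lmodType K) p k (F : seq nat -> V) u v :
  size u = p -> heckes (iota p k) F (u ++ v) = heckes (iota 0 k) (fun v' => F (u ++ v')) v.
Proof.
move=> <-; rewrite -[X in iota X _]addn0 iotaDl; move: (iota 0 k) => s.
elim: s v => //= a s IHs v.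
rewrite -(eq_hecke_all _ IHs); move: (heckes _ F) => G.
by elim: u G {IHs} => //= x u IHu G; rewrite IHu.
Qed.

(** First step of a sweep: either [x] stays in place and [y] travels on, weighted by the diagonal
    coefficient, or [y] stays and [x] travels on. *)
Lemma heckesS (V : lmodType K) k (F : seq nat -> V) x y w :
  heckes (iota 0 k.+1) F [:: x, y & w] =
    hecke_diag x y *: heckes (iota 0 k) (fun v => F (x :: v)) (y :: w)
    + heckes (iota 0 k) (fun v => F (y :: v)) (x :: w).
Proof.
rewrite /=; congr (_ *: _ + _).
  by rewrite -(@heckes_shift _ 1 k F [:: x]).
by rewrite -(@heckes_shift _ 1 k F [:: y]).
Qed.

(** * Commutation of distant operators and the braid relation *)

Lemma hecke_far (V : lmodType K) a (F : seq nat -> V) w :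
  hecke a.+2 (hecke 0 F) w = hecke 0 (hecke a.+2 F) w.
Proof.
case: w => [|x [|y w]] //=; rewrite -hecke_linear; exact: eq_hecke_all.
Qed.

Lemma hecke_braid (F : seq nat -> K^o) w : q != 0 ->
  hecke 1 (hecke 0 (hecke 1 F)) w = hecke 0 (hecke 1 (hecke 0 F)) w.
Proof.
move=> q0; case: w => [|x [|y [|z w]]] //=; rewrite ?scaler0 ?addr0 //.
rewrite /GRing.scale /=.
rewrite /hecke_diag.
case: (ltngtP x y) => xy; case: (ltngtP x z) => xz; case: (ltngtP y z) => yz; try (exfalso; lia);
  subst; rewrite ?ltnn ?eqxx; try ring; by field.
Qed.

Lemma heckes_cons (V : lmodType K) a s (F : seq nat -> V) :
  heckes (a :: s) F = hecke a (heckes s F).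
Proof. by []. Qed.

Lemma hecke_heckes_far (V : lmodType K) s (F : seq nat -> V) w :
  hecke 0 (heckes [seq a.+2 | a <- s] F) w = heckes [seq a.+2 | a <- s] (hecke 0 F) w.
Proof.
elim: s w => // a s IHs w; rewrite map_cons !heckes_cons -hecke_far.
exact: eq_hecke_all.
Qed.

(** A full sweep conjugates each operator to its neighbour: one braid move does the shift, and the
    other factors are far enough away to commute. This lets antisymmetry of a block pass through a
    letter that crosses the block. *)
Lemma hecke_cross k a (F : seq nat -> K^o) w : q != 0 -> (a.+1 < k)%N ->
  hecke a.+1 (heckes (iota 0 k) F) w = heckes (iota 0 k) (hecke a F) w.
Proof.
move=> q0; elim: k a F w => // k IHk [|a] F w lak.
  case: k lak {IHk} => // k _.
  have -> : iota 0 k.+2 = [:: 0, 1 & [seq a.+2 | a <- iota 0 k]]%N.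
    by rewrite -[iota 0 _]/[:: 0, 1 & iota 2 k]%N -[2%N]addn0 iotaDl.
  rewrite !heckes_cons hecke_braid //.
  by apply: eq_hecke_all => u; apply: eq_hecke_all => v; exact: hecke_heckes_far.
rewrite -[iota 0 k.+1]/(0%N :: iota 1 k) !heckes_cons hecke_far; 
apply: eq_hecke_all => -[|x v]; first by case: k lak {IHk}.
rewrite -[RHS]/(heckes (iota 1 k) (hecke a.+1 F) ([:: x] ++ v)) heckes_shift //.
rewrite -[RHS]/(heckes (iota 0 k) (hecke a (fun v' => F (x :: v'))) v) -IHk //.
rewrite -[LHS]/(hecke a.+1 (fun v' => heckes (iota 1 k) F (x :: v')) v).
apply: eq_hecke_all => u.
by rewrite -[x :: u]/([:: x] ++ u) heckes_shift.
Qed.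

(** * Antisymmetric functions and the q-sign *)

Definition antisym (V : lmodType K) (Q : pred nat) (k : nat) (F : seq nat -> V) : Prop :=
  forall a w, word Q k w -> (a.+1 < k)%N -> hecke a F w = (- q^-1) *: F w.

(** This is [- q] to the number of inversions, and zero on words with a repeated letter. *)
Fixpoint qsgn (u : seq nat) : K^o :=
  if u is x :: v then
    if x \in v then 0 else (- q) ^+ count (fun y => y < x)%N v * qsgn v
  else 1.

Hypothesis q_neq0 : q != 0.
Hypothesis q_sqr : q ^+ 2 != -1.

Lemma qsgn_eq0 u : (qsgn u == 0) = ~~ uniq u.
Proof.
elim: u => [|x u IHu] /=; first by rewrite oner_eq0.
case: (x \in u) => /=; first by rewrite eqxx.
by rewrite mulf_eq0 expf_eq0 oppr_eq0 (negPf q_neq0) andbF IHu.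
Qed.

Lemma antisym_cons (V : lmodType K) Q k (F : seq nat -> V) x :
  antisym Q k.+1 F -> Q x -> antisym Q k (fun v => F (x :: v)).
Proof.
by move=> aF Qx a w Hw lak; apply: (aF a.+1 (x :: w)) => //; rewrite word_cons Qx.
Qed.

Lemma antisym_swap (V : lmodType K) Q k (F : seq nat -> V) x y w :
  antisym Q k F -> word Q k [:: x, y & w] -> (y < x)%N ->
  F [:: x, y & w] = - q *: F [:: y, x & w].
Proof.
move=> aF Hw ltyx; have lk : (1 < k)%N by case/andP: Hw => /eqP <-.
have /= := aF 0%N _ Hw lk; rewrite /hecke_diag gtn_eqF // ltnNge (ltnW ltyx) /=.
by rewrite scale0r add0r => ->; rewrite scalerA mulrNN divff // scale1r.
Qed.

(** On two equal adjacent letters the operator acts by [q], while antisymmetry demands [- q^-1]; the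
    two differ because [q ^+ 2 != -1]. *)
Lemma antisym_eq0 (V : lmodType K) Q k (F : seq nat -> V) x w :
  antisym Q k F -> word Q k [:: x, x & w] -> F [:: x, x & w] = 0.
Proof.
move=> aF Hw; have lk : (1 < k)%N by case/andP: Hw => /eqP <-.
have /= := aF 0%N _ Hw lk; rewrite /hecke_diag eqxx -[X in _ + X]scale1r -scalerDl subrK.
move/eqP; rewrite -subr_eq0 -scalerBl opprK scaler_eq0 => /orP[|/eqP//].
rewrite -(inj_eq (mulfI q_neq0)) mulrDr divff // mulr0 -expr2 addr_eq0.
by rewrite (negPf q_sqr).
Qed.

Lemma sort_leq_cons y w : all (leq y) w -> sort leq (y :: w) = y :: sort leq w.
Proof.
move=> Hy; apply: (sorted_eq leq_trans anti_leq).
- exact: sort_sorted leq_total _.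
- by rewrite /= (path_sortedE leq_trans) all_sort Hy sort_sorted //; exact: leq_total.
- by rewrite perm_sort perm_cons perm_sym perm_sort.
Qed.

(** Insertion sort by adjacent swaps: [x] pays a factor [- q] for each smaller letter it passes, and
    the value vanishes if it meets an equal one. *)
Lemma antisym_insert (V : lmodType K) Q k (F : seq nat -> V) x w :
  sorted leq w -> antisym Q k.+1 F -> word Q k.+1 (x :: w) ->
  F (x :: w) = (if x \in w then 0 else (- q) ^+ count (fun y => y < x)%N w)
                  *: F (sort leq (x :: w)).
Proof.
elim: w k F => [|y w IHw] k F; first by rewrite scale1r.
rewrite /= (path_sortedE leq_trans) => /andP[Hy sw] aF Hw.
rewrite in_cons; case: (ltngtP x y) => [ltxy|ltyx|eqxy] /=.
- have Hx : all (leq x) (y :: w).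
    by rewrite /= ltnW //=; apply: sub_all Hy => z; apply: leq_trans (ltnW ltxy).
  rewrite sort_leq_cons // sort_leq_cons // sorted_sort //; last exact: leq_trans.
  have -> : (x \in w) = false.
    by apply/negP => /(allP Hy); rewrite leqNgt ltxy.
  have -> : count (fun z => z < x)%N w = 0%N.
    apply/eqP; rewrite -leqn0 leqNgt -has_count; apply/hasPn => z /(allP Hy) leyz.
    by rewrite -leqNgt (leq_trans (ltnW ltxy)).
  by rewrite scale1r.
- have -> : sort leq [:: x, y & w] = y :: sort leq (x :: w).
    rewrite -sort_leq_cons /= ?(ltnW ltyx) //.
    by apply/perm_sortP => //; [exact: leq_total | exact: leq_trans | exact: anti_leq
      | apply/permPl; exact: (perm_catCA [:: x] [:: y] w)].
  rewrite (antisym_swap aF Hw ltyx).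
  move: Hw; rewrite word_cons => /andP[Qx]; case: k aF => [|k] aF; first by rewrite /word.
  rewrite word_cons => /andP[Qy Hw].
  rewrite (IHw k (fun v => F (y :: v))) //.
  + by case: ifP; rewrite scalerA ?mulr0 // exprS.
  + exact: antisym_cons.
  + by rewrite word_cons Qx.
- by rewrite eqxy in Hw *; rewrite (antisym_eq0 aF Hw) scale0r.
Qed.

Lemma word_sort Q k w : word Q k (sort leq w) = word Q k w.
Proof. by rewrite /word size_sort all_sort. Qed.

(** An antisymmetric function is thus determined by its values on sorted words. In particular those
    on [m] letters from an [m]-element alphabet form a line, since only one sorted word has distinct
    letters. *)
Lemma antisym_sort (V : lmodType K) Q k (F : seq nat -> V) w :
  antisym Q k F -> word Q k w -> F w = qsgn w *: F (sort leq w).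
Proof.
elim: w k F => [|x w IHw] k F aF; first by rewrite scale1r.
case: k aF => [|k] aF; first by rewrite /word.
move=> Hxw; have := Hxw; rewrite word_cons => /andP[Qx Hw].
rewrite (IHw k (fun v => F (x :: v))) //; last exact: antisym_cons.
rewrite (antisym_insert (sort_sorted leq_total w) aF); last by rewrite word_cons Qx word_sort.
rewrite mem_sort count_sort scalerA /= .
have -> : sort leq (x :: sort leq w) = sort leq (x :: w).
  by apply/perm_sortP; [exact: leq_total | exact: leq_trans | exact: anti_leq
      | rewrite perm_cons perm_sort].
by case: ifP; rewrite ?mulr0 ?scale0r // mulrC.
Qed.

Lemma hecke_mull (c F : seq nat -> K^o) a w :
  (forall u v x y, c (u ++ [:: x, y & v]) = c (u ++ [:: y, x & v])) ->
  hecke a (fun v => c v * F v : K^o) w = c w * hecke a F w.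
Proof.
elim: a c F w => [|a IHa] c F [|x w] Hc //=; rewrite ?mulr0 //; last first.
  by rewrite (IHa (fun v => c (x :: v))) // => u v y z; exact: (Hc (x :: u)).
case: w => [|y w]; first by rewrite mulr0.
rewrite (Hc [::] w y x) mulrDr; congr (_ + _).
by rewrite /GRing.scale /= mulrCA.
Qed.

Lemma hecke_qsgn a w : (a.+1 < size w)%N -> hecke a qsgn w = (- q^-1) *: qsgn w.
Proof.
elim: a w => [|a IHa] [|x w] //.
  case: w => [|y w] // _; rewrite /= /hecke_diag !in_cons /GRing.scale /=.
  case: (ltngtP x y) => [lt|lt|->]; rewrite /= ?mulr0 ?addr0 //; case: (x \in w); case: (y \in w);
    rewrite /= ?mulr0 ?mul0r ?addr0 // ?exprS; set c := (- q) ^+ _; set d := (- q) ^+ _.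
  - by field.
  - by field.
rewrite ltnS => law.
(* The first letter contributes a factor depending only on the multiset of the remaining letters, so
   the operator on those letters passes through it. *)
pose c v : K^o := if x \in v then 0 else (- q) ^+ count (fun y => y < x)%N v.
have E v : qsgn (x :: v) = c v * qsgn v by rewrite /c /=; case: ifP; rewrite ?mul0r.
rewrite E [RHS]mulrCA -[- q^-1 * _]/(- q^-1 *: qsgn w) -IHa // -hecke_mull.
  rewrite -[LHS]/(hecke a (fun v => qsgn (x :: v)) w).
  by apply: eq_hecke_all => v; exact: E.
move=> u v y z; have P : perm_eq (u ++ [:: y, z & v]) (u ++ [:: z, y & v]).
  by rewrite perm_cat2l; apply/permPl; exact: (perm_catCA [:: y] [:: z] v).
by rewrite /c (perm_mem P) (seq.permP P).
Qed.

(** * Letters crossing an antisymmetric block *)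

Lemma hecke_catr (V : lmodType K) a (F : seq nat -> V) w t :
  (a.+1 < size w)%N -> hecke a F (w ++ t) = hecke a (fun v => F (v ++ t)) w.
Proof.
by elim: a F w => [|a IHa] F [|x w] //; [case: w | move=> law; apply: IHa].
Qed.

(** [p] records the letters of the block already left behind by the sweep, and [k] counts the block
    positions still to be filled; [g] is an arbitrary function of what follows the block. *)
Definition block (p : seq nat) (k : nat) (g : seq nat -> K^o) (v : seq nat) : K^o :=
  qsgn (p ++ take k v) * g (drop k v).

Lemma hecke_take (F g : seq nat -> K^o) k a w : (a.+1 < k)%N ->
  hecke a (fun v => F (take k v) * g (drop k v) : K^o) w = hecke a F (take k w) * g (drop k w).
Proof.
elim: a k F w => [|a IHa] [|k] F [|x w] // lak; rewrite ?mul0r //; last first.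
  exact: (IHa k (fun v => F (x :: v))).
case: k lak => // k _; case: w => [|y w]; first by rewrite mul0r.
by rewrite /= mulrDl /GRing.scale /= mulrA.
Qed.

Lemma hecke_block k g a w : (a.+1 < k)%N -> (k <= size w)%N ->
  hecke a (block [::] k g) w = - q^-1 * block [::] k g w.
Proof.
move=> lak lkw; rewrite [LHS](@hecke_take qsgn) // hecke_qsgn ?size_takel // /block.
by rewrite -mulrA.
Qed.

Lemma heckes_block_dup p k g w : ~~ uniq p -> heckes (iota 0 k) (block p k g) w = 0.
Proof.
move=> up; rewrite -[RHS](scale0r (heckes (iota 0 k) (block p k g) w)) -heckes_scale.
apply: eq_heckes_all => v; rewrite scale0r /block; suff /eqP -> : qsgn (p ++ take k v) == 0 by rewrite mul0r.
by rewrite qsgn_eq0 cat_uniq negb_and up.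
Qed.

Lemma block_cons p k g x : (fun v => block p k.+1 g (x :: v)) =1 block (rcons p x) k g.
Proof. by move=> v; rewrite /block /= -cat_rcons. Qed.

(** Leaving [x] behind would repeat a letter in the block and give zero, so only the swap terms
    survive and [x] is carried to the far end. *)
Lemma heckes_block_mem p u t g x : x \in p -> x \notin u ->
  heckes (iota 0 (size u)) (block p (size u) g) (x :: u ++ t) = qsgn (p ++ u) * g (x :: t).
Proof.
elim: u p => [|y u IHu] p xp; first by rewrite /= /block take0 drop0 cats0.
rewrite in_cons negb_or => /andP[nxy xu].
rewrite [size _]/= heckesS !(eq_heckes_all _ (block_cons _ _ _ _)).
rewrite heckes_block_dup ?scaler0 ?add0r; last by rewrite rcons_uniq xp.
by rewrite IHu ?mem_rcons ?in_cons ?xp ?orbT // cat_rcons.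
Qed.

(** As a function of [u] the left side is antisymmetric, hence a multiple of [qsgn]. The multiple is
    read off at a word starting with [x], where the first operator meets two equal letters and
    contributes [q]. *)
Lemma heckes_block m g x u t : word (mem (iota 1 m)) m u -> x \in iota 1 m ->
  heckes (iota 0 m) (block [::] m g) (x :: u ++ t) = q * (qsgn u * g (x :: t)).
Proof.
move=> Wu xm; pose s v := heckes (iota 0 m) (block [::] m g) (x :: v ++ t).
have as_ : antisym (mem (iota 1 m)) m s.
  move=> a w Hw lam; have sw : size w = m by case/andP: Hw => /eqP.
  transitivity (hecke a.+1 (heckes (iota 0 m) (block [::] m g)) (x :: w ++ t)).
    by rewrite -(hecke_catr (fun v => heckes (iota 0 m) (block [::] m g) (x :: v))) ?sw.
  rewrite hecke_cross // -heckes_scale.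
  apply: (@eq_heckes _ predT (size (x :: w ++ t))) => [v|]; last by rewrite /word eqxx; apply/allP.
  case/andP => /eqP sv _; rewrite hecke_block // sv /= size_cat sw; lia.
rewrite -/(s u) (antisym_sort as_ Wu).
have [/eqP -> |] := boolP (qsgn u == 0); first by rewrite scale0r mul0r mulr0.
rewrite qsgn_eq0 negbK => uu.
have [su /allP am] := andP Wu.
(* [u] consists of [m] distinct letters of [1..m], so it exhausts this alphabet. *)
have xu : x \in u.
  have sub : {subset u <= iota 1 m} by move=> y /am.
  by have [|_ ->] := uniq_min_size uu sub; rewrite ?size_iota ?(eqP su).
pose u0 := x :: rem x u.
have pu : perm_eq u u0 by exact: perm_to_rem.
have Wu0 : word (mem (iota 1 m)) m u0.
  by rewrite /word -(perm_size pu) -(perm_all _ pu).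
have -> : sort leq u = sort leq u0.
  by apply/perm_sortP => //; [exact: leq_total | exact: leq_trans | exact: anti_leq].
have u0u : uniq u0 by rewrite -(perm_uniq pu).
have : s u0 = q * (qsgn u0 * g (x :: t)).
  have /eqP Em : size (rem x u) == m.-1 by rewrite size_rem // (eqP su).
  have m1 : m = (size (rem x u)).+1 by rewrite Em prednK //; case: (m) xm.
  (* The diagonal coefficient [q - 1] and the swap, which is trivial on equal letters, add up to
     [q]. *)
  rewrite /s m1 heckesS /hecke_diag eqxx scalerBl scale1r subrK.
  rewrite (eq_heckes_all _ (block_cons _ _ _ _)) heckes_block_mem ?mem_head //.
  by move: u0u; rewrite cons_uniq => /andP[].
rewrite (antisym_sort as_ Wu0) => E.
have nz : qsgn u0 != 0 by rewrite qsgn_eq0 u0u.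
suff -> : s (sort leq u0) = q * g (x :: t) by rewrite /GRing.scale /= mulrCA.
by apply: (mulfI nz); rewrite -[LHS]/(qsgn u0 *: s (sort leq u0)) E mulrCA.
Qed.

(* Row coefficients of a product of two minors, the first of which has been
   moved [k] letters to the right into the second one. *)
Definition nested m k (u : seq nat) : K^o :=
  qsgn (take m (drop k u)) * qsgn (take k u ++ drop (k + m) u).

(** On a word, the letters in positions [k - 1] down to [0] cross, in this order, the block of [m]
    letters that follows them. *)
Fixpoint crossings (V : lmodType K) m k (F : seq nat -> V) : seq nat -> V :=
  if k is j.+1 then heckes (iota j m) (crossings m j F) else F.

Lemma heckes_nested_cat m k p x v t :
  size p = k -> x \in iota 1 m -> word (mem (iota 1 m)) m v ->
  heckes (iota k m) (nested m k) (p ++ x :: v ++ t) = q * nested m k.+1 (p ++ x :: v ++ t).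
Proof.
move=> sp xm Wv; have sv : size v = m by case/andP: Wv => /eqP.
rewrite heckes_shift //.
pose g (s : seq nat) : K^o := qsgn (p ++ s).
transitivity (heckes (iota 0 m) (block [::] m g) (x :: v ++ t)).
  apply: eq_heckes_all => s; rewrite /nested /block drop_size_cat // take_size_cat //.
  by rewrite addnC -drop_drop drop_size_cat.
rewrite heckes_block //; congr (_ * _); rewrite /nested -cat_rcons addnC -drop_drop.
have srp : size (rcons p x) = k.+1 by rewrite size_rcons sp.
by rewrite drop_size_cat // !take_size_cat // drop_size_cat // /g cat_rcons.
Qed.

Lemma heckes_nested m k u : (k < m)%N -> word (mem (iota 1 m)) (m + m) u ->
  heckes (iota k m) (nested m k) u = q * nested m k.+1 u.
Proof.
move=> lkm /andP[/eqP su Hu].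
have lku : (k < size u)%N by rewrite su; lia.
have Eu : u = take k u ++ nth 0%N u k :: take m (drop k.+1 u) ++ drop m (drop k.+1 u).
  by rewrite cat_take_drop -drop_nth // cat_take_drop.
rewrite Eu; apply: heckes_nested_cat.
- by rewrite size_takel // ltnW.
- by apply: (allP Hu); rewrite mem_nth.
- rewrite /word size_takel; last by rewrite size_drop su; lia.
  by rewrite eqxx; apply/allP => y /mem_take /mem_drop /(allP Hu).
Qed.

Lemma crossings_nested m k u : (k <= m)%N -> word (mem (iota 1 m)) (m + m) u ->
  crossings m k (nested m 0) u = q ^+ k * nested m k u.
Proof.
elim: k u => [|k IHk] u lkm Wu; first by rewrite mul1r.
rewrite /= (@eq_heckes _ (mem (iota 1 m)) (m + m) _ _ (fun v => q ^+ k *: nested m k v)) //; last first.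
  by move=> v Wv; rewrite IHk // ltnW.
by rewrite heckes_scale heckes_nested // exprSr -mulrA.
Qed.

(** After all crossings the two blocks have changed places, and their scalar coefficients
    commute. *)
Lemma nested_full m u : size u = (m + m)%N -> nested m m u = nested m 0 u.
Proof.
move=> su; rewrite /nested drop0 take0 take_oversize ?size_drop ?su ?addnK //.
by rewrite (@drop_oversize _ (m + m)) ?su // cats0 mulrC.
Qed.

Lemma crossings_full m u : word (mem (iota 1 m)) (m + m) u ->
  crossings m m (nested m 0) u = q ^+ m * nested m 0 u.
Proof.
by move=> Wu; rewrite crossings_nested // nested_full //; case/andP: Wu => /eqP.
Qed.

(** * Words that arise when crossings act on column indices *)

(** Each position of the block receives either its old letter [y] or the travelling letter [j], the
    latter only when [j <= y] because the diagonal coefficient vanishes otherwise. So the number of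
    letters at most [c] never drops. *)
Lemma heckes_support (V : lmodType K) (P : V -> Prop) (Q : pred nat) c k (F : seq nat -> V) j w t :
  (forall a b, P a -> P b -> P (a + b)) -> (forall (x : K) a, P a -> P (x *: a)) -> P 0 ->
  Q j -> word Q k w ->
  (forall u i, word Q k u -> Q i ->
     (count (fun y => y <= c)%N w <= count (fun y => y <= c)%N u)%N -> P (F (u ++ i :: t))) ->
  P (heckes (iota 0 k) F (j :: w ++ t)).
Proof.
move=> PD PZ P0; elim: k j w F => [|k IHk] j [|y w] F Qj //.
  by move=> _ HF; exact: (HF [::] j).
rewrite word_cons => /andP[Qy Hw] HF; rewrite heckesS; apply: PD; last first.
  apply: IHk => // u i Hu Qi le; apply: (HF (y :: u)); rewrite ?word_cons ?Qy //=.
  by rewrite leq_add2l.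
have [jy|yj] := leqP j y; last first.
  by rewrite /hecke_diag gtn_eqF // ltnNge (ltnW yj) scale0r.
apply: PZ; apply: IHk => // u i Hu Qi le; apply: (HF (j :: u)); rewrite ?word_cons ?Qj //=.
apply: leq_add => //; case: (leqP y c) => // yc; by rewrite (leq_trans jy yc).
Qed.

Lemma crossings_support (V : lmodType K) (P : V -> Prop) (Q : pred nat) c m k (F : seq nat -> V) p w t :
  (forall a b, P a -> P b -> P (a + b)) -> (forall (x : K) a, P a -> P (x *: a)) -> P 0 ->
  word Q k p -> word Q m w -> all Q t ->
  (forall u v, word Q m u -> word Q (k + size t) v ->
     (count (fun y => y <= c)%N w <= count (fun y => y <= c)%N u)%N -> P (F (u ++ v))) ->
  P (crossings m k F (p ++ w ++ t)).
Proof.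
move=> PD PZ P0; elim: k p w t => [|k IHk] p w t.
  by case: p => // _ Hw Ht HF; apply: (HF w t) => //; rewrite /word eqxx.
(* The outermost sweep moves the last letter of the prefix, the one adjacent to the block; it then
   joins the tail [t]. *)
case/lastP: p => // p j; rewrite /word size_rcons eqSS all_rcons andbCA => /andP[Qj Hp] Hw Ht HF.
rewrite /= cat_rcons heckes_shift; last by case/andP: Hp => /eqP.
apply: (heckes_support (Q := Q) (c := c)) => // u i Hu Qi le.
apply: IHk => //=; first by rewrite Qi.
by move=> u' v Hu' Hv le'; apply: HF => //; [rewrite addSnnS | exact: leq_trans le'].
Qed.

(** * Quantum matrices: exchanging row and column operators *)

Section QuantumMinors.
Variables (m n : nat) (A : algType K) (X : nat -> nat -> A).
Hypothesis X_rel : qmat_rel m n q X.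

Let rows := iota 1 m.
Let cols : pred nat := fun j => (1 <= j <= n)%N.

Fixpoint qmono (u c : seq nat) : A :=
  match u, c with x :: u', j :: c' => X x j * qmono u' c' | _, _ => 1 end.

Fixpoint words (S : seq nat) (k : nat) : seq (seq nat) :=
  if k is l.+1 then [seq x :: u | x <- S, u <- words S l] else [:: [::]].

Lemma mem_words S k u : (u \in words S k) = word (mem S) k u.
Proof.
elim: k u => [|k IHk] [|x u] //=.
  by apply/negP => /allpairsP[[y v] [_ _]].
rewrite word_cons -IHk; apply/allpairsP/andP => [[[y v] [/= yS vW [-> ->]]]|[xS uW]] //.
by exists (x, u).
Qed.

Lemma words_uniq S k : uniq S -> uniq (words S k).
Proof.
move=> uS; elim: k => //= k IHk; apply: allpairs_uniq => // -[x u] [y v] _ _ /= [-> ->] //.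
Qed.

(** Pairing of a coefficient function on row words with the monomials of a fixed column word; it
    carries row operators to column operators. *)
Definition rowsum (r : seq nat -> K^o) (c : seq nat) : A :=
  \sum_(u <- words rows (size c)) r u *: qmono u c.

Lemma rowsum_cons r j c :
  rowsum r (j :: c) = \sum_(x <- rows) X x j * rowsum (fun u => r (x :: u)) c.
Proof.
rewrite /rowsum /= big_allpairs_dep; apply: eq_bigr => x _.
by rewrite mulr_sumr; apply: eq_bigr => u _; rewrite /= scalerAr.
Qed.

Lemma eq_rowsum r r' c :
  (forall u, word (mem rows) (size c) u -> r u = r' u) -> rowsum r c = rowsum r' c.
Proof.
move=> E; rewrite /rowsum big_seq [RHS]big_seq; apply: eq_bigr => u.
by rewrite mem_words => /E ->.
Qed.

Lemma rowsum_linear a r r' c :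
  rowsum (fun u => a * r u + r' u) c = a *: rowsum r c + rowsum r' c.
Proof.
rewrite /rowsum scaler_sumr -big_split; apply: eq_bigr => u _ /=.
by rewrite scalerDl scalerA.
Qed.

Lemma rowsum_scale a r c : rowsum (fun u => a * r u) c = a *: rowsum r c.
Proof.
by rewrite /rowsum scaler_sumr; apply: eq_bigr => u _; rewrite scalerA.
Qed.

Lemma hecke_sum (s : seq nat) (b : nat -> A) (F : nat -> seq nat -> A) a w :
  hecke a (fun v => \sum_(x <- s) b x * F x v) w = \sum_(x <- s) b x * hecke a (F x) w.
Proof.
have z : \sum_(x <- s) b x * 0 = 0 by rewrite big1 // => x _; rewrite mulr0.
elim: a F w => [|a IHa] F [|x w] //=; first by case: w => [|y w] //;
  rewrite scaler_sumr -big_split; apply: eq_bigr => t _; rewrite /= mulrDr scalerAr.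
Qed.

Lemma rows_bound x : (x \in rows) = (1 <= x <= m)%N.
Proof. by rewrite mem_iota add1n ltnS. Qed.

(** The defining relations in RTT form: all relative orders of the rows and of the columns are
    captured by one identity, with the same operator on both sides. *)
Lemma rtt x y j l : x \in rows -> y \in rows -> cols j -> cols l ->
  hecke_diag x y *: (X x j * X y l) + X y j * X x l
  = hecke_diag j l *: (X x j * X y l) + X x l * X y j.
Proof.
rewrite !rows_bound => xr yr jc lc; rewrite /hecke_diag.
have [R1 R2 R3 R4] := X_rel xr yr jc lc.
have [S1 S2 S3 S4] := X_rel xr yr lc jc.
have [T1 T2 T3 T4] := X_rel yr xr jc lc.
have [U1 U2 U3 U4] := X_rel yr xr lc jc.
case: (ltngtP x y) => [xy|yx|exy]; case: (ltngtP j l) => [jl|lj|ejl]; rewrite ?scale0r ?add0r.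
- by rewrite T3.
- by rewrite -S4 // subrK.
- rewrite -ejl R2 // !scalerA -[X in _ + X = _]scale1r -!scalerDl; by congr (_ *: _); field; rewrite q_neq0.
- by rewrite R3 // -T4 // subrK.
- by rewrite S3.
- by rewrite -ejl T2 // scalerBl scale1r subrK.
- rewrite -exy R1 // !scalerA -[X in _ = _ + X]scale1r -!scalerDl; by congr (_ *: _); field; rewrite q_neq0.
- by rewrite -exy S1 // scalerBl scale1r subrK.
- by rewrite -exy -ejl.
Qed.

Lemma rowsum_hecke a r c : all cols c -> rowsum (hecke a r) c = hecke a (rowsum r) c.
Proof.
elim: a r c => [|a IHa] r [|j c] //=.
- by rewrite /rowsum /= big_seq1 scale0r.
- case: c => [|l c] /andP[jc].
    move=> _; rewrite rowsum_cons big1 // => x _.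
    by rewrite (@eq_rowsum _ (fun u => 0 * 0)) ?rowsum_scale ?scale0r ?mulr0 // => -[|y u] //; rewrite mul0r.
  case/andP => lc _; rewrite !rowsum_cons scaler_sumr.
  pose T x y := rowsum (fun u => r [:: x, y & u]) c.
  transitivity (\sum_(x <- rows) \sum_(y <- rows)
      (hecke_diag x y *: (X x j * X y l * T x y) + X x j * X y l * T y x)).
    apply: eq_bigr => x _; rewrite rowsum_cons mulr_sumr; apply: eq_bigr => y _.
    by rewrite rowsum_linear mulrDr mulrDr !scalerAr mulrA mulrA.
  (* Renaming [x] and [y] in the swap term moves the row operator from the coefficients to the
     monomials, where [rtt] applies. *)
  transitivity (\sum_(x <- rows) \sum_(y <- rows)
      (hecke_diag x y *: (X x j * X y l) + X y j * X x l) * T x y).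
    under eq_bigr do rewrite big_split /=.
    rewrite big_split /= [X in _ + X]exchange_big -big_split; apply: eq_bigr => x _.
    rewrite -big_split; apply: eq_bigr => y _ /=.
    by rewrite mulrDl scalerAl.
  rewrite -big_split big_seq [RHS]big_seq; apply: eq_bigr => x xr /=.
  rewrite !rowsum_cons !mulr_sumr scaler_sumr -big_split big_seq [RHS]big_seq.
  apply: eq_bigr => y yr; rewrite rtt // mulrDl !mulrA -!scalerAl.
  by rewrite /T.
- by rewrite /rowsum big_seq1 scale0r.
- case/andP => jc Hc; rewrite rowsum_cons.
  transitivity (hecke a (fun v => \sum_(x <- rows) X x j * rowsum (fun u => r (x :: u)) v) c).
    by rewrite hecke_sum; apply: eq_bigr => x _; rewrite -IHa.
  by apply: eq_hecke_all => v; rewrite rowsum_cons.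
Qed.

Lemma rowsum_heckes s r k c : word cols k c -> rowsum (heckes s r) c = heckes s (rowsum r) c.
Proof.
elim: s c => //= a s IHs c Wc; rewrite rowsum_hecke; last by case/andP: Wc.
by apply: (@eq_hecke _ cols k) => // v /IHs.
Qed.

Lemma rowsum_crossings p k r l c : word cols l c ->
  rowsum (crossings p k r) c = crossings p k (rowsum r) c.
Proof.
elim: k c => //= k IHk c Wc; rewrite (rowsum_heckes _ _ Wc).
by apply: (@eq_heckes _ cols l) => // v /IHk.
Qed.

Lemma rowsum_cat r r' c c' :
  rowsum (fun u => r (take (size c) u) * r' (drop (size c) u)) (c ++ c') = rowsum r c * rowsum r' c'.
Proof.
elim: c r => [|j c IHc] r.
  rewrite {2}/rowsum /= big_seq1 -scalerAl mul1r -rowsum_scale.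
  by apply: eq_rowsum => u _; rewrite take0 drop0.
rewrite !rowsum_cons mulr_suml; apply: eq_bigr => x _.
by rewrite -mulrA -IHc.
Qed.

(** The quantum minor with its columns in fixed order and its rows permuted. It makes sense for any
    column word, which the crossings require. *)
Definition rowminor : seq nat -> A := rowsum qsgn.

Lemma antisym_rowminor : antisym cols m rowminor.
Proof.
move=> a w Ww lam; have /andP[/eqP sw Hw] := Ww.
rewrite /rowminor -rowsum_hecke // -rowsum_scale; apply: eq_rowsum => u /andP[/eqP su _].
by rewrite hecke_qsgn // su sw.
Qed.

Lemma rowminor_mul u v : size u = m -> rowminor u * rowminor v = rowsum (nested m 0) (u ++ v).
Proof.
move=> su; rewrite -rowsum_cat; apply: eq_rowsum => w _.
by rewrite /nested drop0 take0 su.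
Qed.

(** The crossings multiply the row coefficients of the product by [q ^+ m]; the same crossings may
    be applied to the columns instead. *)
Lemma rowminor_mul_crossings u v : word cols m u -> word cols m v ->
  rowminor u * rowminor v = q ^- m *: crossings m m (rowsum (nested m 0)) (u ++ v).
Proof.
move=> Wu Wv; have /andP[/eqP su _] := Wu; have /andP[/eqP sv _] := Wv.
have Wuv : word cols (m + m) (u ++ v) by rewrite word_cat // Wu.
rewrite -(rowsum_crossings _ _ _ Wuv) (@eq_rowsum _ (fun w => q ^+ m * nested m 0 w)).
  by rewrite rowsum_scale scalerA mulVf ?expf_neq0 // scale1r rowminor_mul.
by move=> w; rewrite size_cat su sv => Ww; rewrite crossings_full.
Qed.

(** * Agreement of the row and column expansions of a minor *)

(** Common form of both expansions: [S] holds the indices being permuted, while the other indices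
    are fixed inside [f]. *)
Definition altsum (S : seq nat) (f : seq nat -> A) : A :=
  \sum_(u <- permutations S) qsgn u *: f u.

Lemma permutations_cons S : uniq S -> (0 < size S)%N ->
  perm_eq (permutations S) [seq x :: u | x <- S, u <- @permutations nat (rem x S)].
Proof.
move=> uS S0; apply: uniq_perm; first exact: permutations_uniq.
  apply: allpairs_uniq_dep => // [x _|[x u] [y v] _ _ /= [-> ->] //].
  exact: permutations_uniq.
move=> [|x u]; rewrite mem_permutations.
  apply/idP/allpairsPdep => [/perm_size sS|[y [v [_ _]]] //].
  by rewrite -sS in S0.
apply/idP/allpairsPdep => [pS|[y [v [yS]]]].
  have xS : x \in S by rewrite -(perm_mem pS) mem_head.
  exists x, u; split=> //; rewrite mem_permutations -(perm_cons x).
  exact: perm_trans pS (perm_to_rem xS).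
rewrite mem_permutations -(perm_cons y) => pS [-> ->].
by rewrite (perm_trans pS) // perm_sym perm_to_rem.
Qed.

Lemma altsum_cons S f : uniq S -> (0 < size S)%N ->
  altsum S f = \sum_(x <- S) (- q) ^+ count (fun y => y < x)%N S
                 *: altsum (rem x S) (fun u => f (x :: u)).
Proof.
move=> uS S0; rewrite /altsum (perm_big _ (permutations_cons uS S0)) /= big_allpairs_dep.
rewrite big_seq [RHS]big_seq; apply: eq_bigr => x xS.
rewrite scaler_sumr big_seq [RHS]big_seq; apply: eq_bigr => u.
rewrite mem_permutations => pu.
rewrite /= (perm_mem pu) mem_rem_uniqF // scalerA (seq.permP pu).
by rewrite (seq.permP (perm_to_rem xS) (fun y => y < x)%N) /= ltnn.
Qed.

Lemma sorted_ltn_cons x S : sorted ltn (x :: S) = all (fun y => x < y)%N S && sorted ltn S.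
Proof. exact: (path_sortedE ltn_trans). Qed.

Lemma sorted_rem x S : sorted ltn S -> sorted ltn (rem x S).
Proof. exact: subseq_sorted ltn_trans _ _ (rem_subseq x S). Qed.

Lemma all_rem (Q : pred nat) x S : all Q S -> all Q (rem x S).
Proof. by move=> QS; apply/allP => y /mem_rem /(allP QS). Qed.

Lemma altsum_mull S f b : altsum S (fun u => b * f u) = b * altsum S f.
Proof. by rewrite /altsum mulr_sumr; apply: eq_bigr => u _; rewrite scalerAr. Qed.

(** The least letter [c] in front creates no inversion; any other first letter [x] has one inversion
    with [c], whence the extra [.+1]. *)
Lemma altsum_ltn_cons c C f : sorted ltn (c :: C) ->
  altsum (c :: C) f = altsum C (fun u => f (c :: u))
    + \sum_(x <- C) (- q) ^+ (count (fun y => y < x)%N C).+1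
         *: altsum (c :: rem x C) (fun u => f (x :: u)).
Proof.
move=> sC; have := sC; rewrite sorted_ltn_cons => /andP[/allP cC _].
rewrite altsum_cons ?(sorted_uniq ltn_trans ltnn) // big_cons /= eqxx ltnn.
congr (_ + _).
  rewrite (_ : count _ _ = 0%N) ?scale1r //.
  apply/eqP; rewrite -leqn0 leqNgt -has_count; apply/hasPn => y /cC cy.
  by rewrite -leqNgt ltnW.
rewrite big_seq [RHS]big_seq; apply: eq_bigr => x /cC cx.
by rewrite cx add1n ltn_eqF.
Qed.

(* Expanding along the first row and then the first column, or the other way
   round, gives the same sum because X_{r x} and X_{y c} commute for r < y, c < x. *)
Lemma altsum_transpose R C : size R = size C -> sorted ltn R -> sorted ltn C ->
  all (mem rows) R -> all cols C ->
  altsum R (qmono^~ C) = altsum C (qmono R).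
Proof.
have [k] := ubnP (size R); elim: k R C => // k IHk [|r R] [|c C] //.
  by move=> *; rewrite /altsum; apply: eq_bigr => -[|x u].
move=> /= ltk [sRC] sR sC; case/andP=> rr HR /andP[cc HC].
have := sR; rewrite -[path _ _ _]/(sorted ltn (r :: R)) sorted_ltn_cons => /andP[/allP rR sR'].
have := sC; rewrite -[path _ _ _]/(sorted ltn (c :: C)) sorted_ltn_cons => /andP[/allP cC sC'].
rewrite !altsum_ltn_cons //= !altsum_mull; congr (_ * _ + _); first by apply: IHk.
transitivity (\sum_(y <- R) \sum_(x <- C)
   (- q) ^+ (count (fun z => z < y)%N R + count (fun z => z < x)%N C).+1
     *: (X y c * (X r x * altsum (rem x C) (qmono (rem y R))))).
  rewrite big_seq [RHS]big_seq; apply: eq_bigr => y yR.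
  have sy : size (rem y R) = (size R).-1 by rewrite size_rem.
  have R0 : (0 < size R)%N by case: (R) yR.
  rewrite altsum_mull IHk //=.
  - rewrite altsum_cons ?(sorted_uniq ltn_trans ltnn) // -?sRC // mulr_sumr scaler_sumr.
    apply: eq_bigr => x _; rewrite altsum_mull -scalerAr scalerA -exprD addSn.
    by [].
  - by rewrite sy prednK // .
  - by rewrite sy prednK.
  - rewrite -[path _ _ _]/(sorted ltn (r :: _)) sorted_ltn_cons sorted_rem // andbT.
    by apply/allP => z /mem_rem /rR.
  - by rewrite rr all_rem.
rewrite exchange_big big_seq [RHS]big_seq; apply: eq_bigr => x xC.
have sx : size (rem x C) = (size C).-1 by rewrite size_rem.
have C0 : (0 < size C)%N by case: (C) xC.
rewrite altsum_mull -IHk //=.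
- rewrite altsum_cons ?(sorted_uniq ltn_trans ltnn) // ?sRC // mulr_sumr scaler_sumr.
  rewrite big_seq [RHS]big_seq; apply: eq_bigr => y yR.
  rewrite altsum_mull IHk ?sorted_rem ?all_rem ?size_rem ?sRC //; last first.
    by rewrite -sRC; case: (size R) ltk => // l; rewrite ltnS => /ltnW.
  rewrite -scalerAr scalerA -exprD addSn [(count _ C + _)%N]addnC !mulrA; congr (_ *: (_ * _)).
  have xc : cols x by exact: (allP HC).
  have yr : y \in rows by exact: (allP HR).
  rewrite rows_bound in yr; rewrite rows_bound in rr.
  by have [_ _ -> //] := X_rel yr rr cc xc; [exact: rR | exact: cC].
- by rewrite sx prednK // -sRC.
- rewrite -[path _ _ _]/(sorted ltn (c :: _)) sorted_ltn_cons sorted_rem // andbT.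
  by apply/allP => z /mem_rem /cC.
- by rewrite cc all_rem.
Qed.

Lemma perm_words_uniq S : uniq S ->
  perm_eq [seq u <- words S (size S) | uniq u] (permutations S).
Proof.
move=> uS; apply: uniq_perm; rewrite ?filter_uniq ?words_uniq ?permutations_uniq // => u.
rewrite mem_filter mem_words mem_permutations /word.
apply/idP/idP => [/and3P[uu /eqP su /allP Su]|pu].
  have sub : {subset u <= S} by move=> y /Su.
  by have [|_ E] := uniq_min_size uu sub; rewrite ?su //; apply: uniq_perm.
rewrite (perm_uniq pu) uS (perm_size pu) eqxx; apply/allP => x.
by rewrite (perm_mem pu).
Qed.

Lemma rowminorE c : size c = m -> rowminor c = altsum rows (qmono^~ c).
Proof.
move=> sc; have uR : uniq rows by exact: iota_uniq.
rewrite /altsum -(perm_big _ (perm_words_uniq uR)) /= big_filter size_iota.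
rewrite /rowminor /rowsum sc [RHS]big_mkcond; apply: eq_bigr => u _.
by case: ifPn => //; rewrite -qsgn_eq0 => /eqP ->; rewrite scale0r.
Qed.

Lemma qsgn_inversions u : uniq u ->
  qsgn u = (- q) ^+ (\sum_(i < size u) \sum_(j < size u)
                       ((i < j) && (nth 0 u j < nth 0 u i)))%N.
Proof.
elim: u => [|x u IHu] /=; first by rewrite big_ord0.
case/andP => /negPf -> /IHu ->; rewrite -exprD; congr (_ ^+ _).
rewrite big_ord_recl big_ord_recl /= add0n; congr (_ + _)%N.
  by rewrite -sum1_count big_mkcond /= (big_nth 0%N) big_mkord; apply: eq_bigr => i _; case: ifP.
by apply: eq_bigr => i _; rewrite big_ord_recl.
Qed.

Lemma qmono_iota a k c : size c = k -> qmono (iota a k) c = \prod_(i < k) X (a + i)%N (nth 0%N c i).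
Proof.
elim: k a c => [|k IHk] a [|j c] //=; first by rewrite big_ord0.
by case=> sc; rewrite big_ord_recl addn0 IHk //; congr (_ * _); apply: eq_bigr => i _; rewrite addSnnS.
Qed.

Lemma qminorE J : sorted ltn J -> size J = m -> qminor m q X J = altsum J (qmono rows).
Proof.
move=> sJ szJ; have uJ : uniq J by exact: (sorted_uniq ltn_trans ltnn).
(* [w s] lists the columns in the order of the factors in the term of [s]. All positions are below
   [m], so the default [0] is never reached; as [J] increases, [w s] and [s] have the same
   inversions. *)
pose w (s : 'S_m) := mkseq (fun k => nth 0%N J (if insub k is Some i then s i else 0%N)) m.
have nthJ (i j : 'I_m) : (nth 0 J i < nth 0 J j)%N = (i < j)%N.
  have mono (k l : 'I_m) : (k < l)%N -> (nth 0 J k < nth 0 J l)%N.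
    by apply: (sorted_ltn_nth ltn_trans 0%N sJ); rewrite inE szJ.
  case: (ltngtP i j) => [/mono //|/mono|/val_inj ->]; last by rewrite ltnn.
  by rewrite ltnNge => /negPf lt; rewrite ltnNge ltnW // ltnNge lt.
have nth_w s (i : 'I_m) : nth 0%N (w s) i = nth 0%N J (s i).
  by rewrite nth_mkseq // valK.
have size_w s : size (w s) = m by rewrite size_mkseq.
have w_inj : injective w.
  move=> s t E; apply/permP => i; apply/val_inj/eqP.
  by rewrite /= -(nth_uniq 0%N _ _ uJ) ?szJ // -!nth_w E.
have perm_w s : perm_eq (w s) J.
  have tJ : size J == m by rewrite szJ.
  apply/(@tuple_permP _ _ _ (Tuple tJ)); exists s.
  apply: (@eq_from_nth _ 0%N); first by rewrite size_w size_tuple.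
  move=> i; rewrite size_w => im; rewrite (nth_w s (Ordinal im)).
  have := tnth_mktuple (fun l => tnth (Tuple tJ) (s l)) (Ordinal im).
  by rewrite !(tnth_nth 0%N) => ->.
have all_w : perm_eq [seq w s | s <- enum 'S_m] (permutations J).
  apply: uniq_perm; rewrite ?permutations_uniq ?(map_inj_uniq w_inj) ?enum_uniq // => u.
  rewrite mem_permutations; apply/mapP/idP => [[s _ ->] //|pu].
  have tJ : size J == m by rewrite szJ.
  have /(@tuple_permP _ _ _ (Tuple tJ)) [s Es] := pu.
  exists s; first by rewrite mem_enum.
  apply: (@eq_from_nth _ 0%N); first by rewrite size_w (perm_size pu).
  move=> i; rewrite (perm_size pu) szJ => im; rewrite (nth_w s (Ordinal im)) Es.
  have := tnth_mktuple (fun l => tnth (Tuple tJ) (s l)) (Ordinal im).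
  by rewrite !(tnth_nth 0%N) => ->.
rewrite /altsum -(perm_big _ all_w) /= big_map big_enum /=; apply: eq_bigr => s _.
rewrite qmono_iota //; congr (_ *: _); last by apply: eq_bigr => i _; rewrite nth_w add1n.
rewrite qsgn_inversions ?(perm_uniq (perm_w s)) // size_w; congr (_ ^+ _).
rewrite /perm_length -sum1_card pair_bigA /= big_mkcond; apply: eq_bigr => -[i j] _ /=.
rewrite inE /= !nth_w nthJ.
by case: ifP.
Qed.

Lemma qminor_rowminor J : Pi m n J -> qminor m q X J = rowminor J.
Proof.
case/and3P => /eqP szJ sJ HJ; rewrite qminorE // rowminorE // altsum_transpose ?size_iota //.
exact: iota_ltn_sorted.
Qed.

Lemma rowminor_sort w : word cols m w -> rowminor w = qsgn w *: rowminor (sort leq w).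
Proof. exact: (antisym_sort antisym_rowminor). Qed.

Lemma Pi_sort w : word cols m w -> uniq w -> Pi m n (sort leq w).
Proof.
case/andP => sw Hw uw; rewrite /Pi size_sort sw all_sort -/cols Hw andbT /=.
by rewrite ltn_sorted_uniq_leq sort_uniq uw sort_sorted //; exact: leq_total.
Qed.

(** A repeated column gives zero; otherwise sorting yields a scalar multiple of a genuine minor. *)
Lemma rowminor_grass w : word cols m w -> qgrass m n q X (rowminor w).
Proof.
move=> Hw; rewrite rowminor_sort //; have [uw|] := boolP (uniq w).
  apply: gen_alg_scale; apply: gen_alg_gen.
  by exists (sort leq w); split; rewrite ?qminor_rowminor ?Pi_sort.
rewrite -qsgn_eq0 => /eqP ->; rewrite scale0r -(scale0r 1).
by apply: gen_alg_scale; exact: gen_alg_one.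
Qed.

(** * The order on column sets and the ideal *)

Lemma not_le_st gamma p : Pi m n gamma -> Pi m n p ->
  ~~ le_st gamma p <-> exists2 s, (s < m)%N & (nth 0 p s < nth 0 gamma s)%N.
Proof.
case/and3P => /eqP sg _ _ /and3P[/eqP sp _ _]; rewrite /le_st -has_predC sg; split.
  by case/hasP => s; rewrite mem_iota /= -ltnNge => sm lt; exists s.
by case=> s sm lt; apply/hasP; exists s; rewrite ?mem_iota //= -ltnNge.
Qed.

(** Turns a bound on one entry of a sorted word into a count of letters, which can be compared
    before sorting. *)
Lemma count_leq_sorted s c u : sorted leq u -> (s < size u)%N ->
  (nth 0 u s <= c)%N = (s < count (fun y => y <= c) u)%N.
Proof.
elim: u s => // x u IHu s su.
have := su; rewrite -[sorted _ _]/(path leq x u) (path_sortedE leq_trans) => /andP[xu su'].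
rewrite /=; have [xc|cx] := leqP x c.
  by case: s => //= s; rewrite !ltnS => su''; rewrite IHu // add1n ltnS.
have -> : count (fun y => y <= c)%N u = 0%N.
  apply/eqP; rewrite -leqn0 leqNgt -has_count; apply/hasPn => y /(allP xu) xy.
  by rewrite -ltnNge (leq_trans cx).
move=> lsu; rewrite addn0 ltn0 leqNgt; apply/negbTE; rewrite negbK.
case: s lsu => //= s; rewrite ltnS => lsu.
by rewrite (leq_trans cx) // (allP xu) // mem_nth.
Qed.

Section Ideal.
Variable gamma : seq nat.
Hypothesis gammaP : Pi m n gamma.

Definition not_above (a : A) : Prop :=
  exists p, [/\ Pi m n p, ~~ le_st gamma p & a = qminor m q X p].

Let I := right_ideal (qgrass m n q X) not_above.

Lemma ideal_scale (x : K) a : I a -> I (x *: a).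
Proof.
move=> Ia; rewrite -[a]mulr1 scalerAr; apply: ri_mulr => //.
by apply: gen_alg_scale; exact: gen_alg_one.
Qed.

Lemma qminor_mul_not_above J p : Pi m n J -> Pi m n p -> ~~ le_st gamma p ->
  I (qminor m q X J * qminor m q X p).
Proof.
move=> PJ Pp /(not_le_st gammaP Pp)[s sm lt].
have Pi_word u : Pi m n u -> word cols m u.
  by case/and3P => su _ Hu; rewrite /word su.
have /and3P[/eqP sp /(sub_sorted ltnW) sp' _] := Pp.
rewrite !qminor_rowminor // rowminor_mul_crossings ?Pi_word //; apply: ideal_scale.
rewrite -[p]cats0.
(* The threshold is the entry [p_s] lying below [gamma_s]: more than [s] letters of [p] are at most
   this value, so the same holds for each left factor [u], and its sorted entry at [s] is again
   below [gamma_s]. *)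
apply: (crossings_support (Q := cols) (c := nth 0%N p s)) => //.
- exact: ri_add.
- exact: ideal_scale.
- exact: ri_zero.
- exact: Pi_word.
- exact: Pi_word.
rewrite /= addn0 => u v Wu Wv le; have /andP[/eqP su _] := Wu.
rewrite -rowminor_mul //; apply: ri_mulr; first exact: rowminor_grass.
rewrite rowminor_sort //; have [uu|] := boolP (uniq u); last first.
  by rewrite -qsgn_eq0 => /eqP ->; rewrite scale0r; exact: ri_zero.
apply: ideal_scale; apply: ri_gen.
have Pu := Pi_sort Wu uu.
exists (sort leq u); split => //; last by rewrite qminor_rowminor.
apply/(not_le_st gammaP Pu); exists s => //; apply: leq_ltn_trans lt.
rewrite (count_leq_sorted _ (sort_sorted leq_total u)) ?size_sort ?su //.
by rewrite count_sort; apply: leq_trans le; rewrite -count_leq_sorted // sp.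
Qed.

Lemma qminor_mul_ideal J a : Pi m n J -> I a -> I (qminor m q X J * a).
Proof.
move=> PJ; elim=> [_ [p [Pp np ->]]||b c _ IHb _ IHc|b r Sr _ IHb].
- exact: qminor_mul_not_above.
- by rewrite mulr0; exact: ri_zero.
- by rewrite mulrDr; exact: ri_add.
- by rewrite mulrA; exact: ri_mulr.
Qed.

(** Being stable under left multiplication passes to sums, products and scalar multiples, so it
    suffices to have it for single minors. *)
Lemma grass_mul_ideal r a : qgrass m n q X r -> I a -> I (r * a).
Proof.
move=> Sr; elim: Sr a => [_ [J [PJ ->]]||b c _ IHb _ IHc|b c _ IHb _ IHc|x b _ IHb] a Ia.
- exact: qminor_mul_ideal.
- by rewrite mul1r.
- by rewrite mulrDl; apply: ri_add; [exact: IHb | exact: IHc].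
- by rewrite -mulrA; apply: IHb; exact: IHc.
- by rewrite -scalerAl; apply: ideal_scale; exact: IHb.
Qed.

Lemma twosided_right_ideal a :
  twosided_ideal (qgrass m n q X) not_above a <-> right_ideal (qgrass m n q X) not_above a.
Proof.
split.
  elim=> {a} [a Ga||a b _ Ia _ Ib|r a Sr _ Ia|a r Sr _ Ia].
  - exact: ri_gen.
  - exact: ri_zero.
  - exact: ri_add.
  - exact: grass_mul_ideal.
  - exact: ri_mulr.
elim=> {a} [a Ga||a b _ Ia _ Ib|a r Sr _ Ia].
- exact: tsi_gen.
- exact: tsi_zero.
- exact: tsi_add.
- exact: tsi_mulr.
Qed.

End Ideal.
End QuantumMinors.
End HeckeAction.

Theorem theorem3p3p3 (R : realType) (m n : nat) (q : R[i])
    (A : algType R[i]) (X : nat -> nat -> A) (gamma : seq nat) :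
  (0 < m)%N -> (m <= n)%N -> q != 0 -> ~ is_root_of_unity_q q ->
  is_qmatrix_algebra m n q X ->
  Pi m n gamma ->
  let G := fun a : A => exists p, [/\ Pi m n p, ~~ le_st gamma p & a = qminor m q X p] in
  forall a : A,
    twosided_ideal (qgrass m n q X) G a <-> right_ideal (qgrass m n q X) G a.
Proof.
move=> _ _ q0 qru [relX _ _] gammaP G a.
(* The eigenvalues [q] and [- q^-1] must differ; [q ^+ 2 = -1] would make [q] a fourth root of
   unity. *)
apply: twosided_right_ideal => //; apply/negP => /eqP q2.
by apply: qru; exists 4%N; split=> //; rewrite (exprM q 2 2) q2 sqrrN expr1n.
Qed.
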